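(* Let $X$ be a smooth $6$-dimensional manifold and let $(\Omega,\omega)\in\Omega^2(X)\times\Omega^3(X)$ be a nondegenerate Monge-Ampère structure on $X$. Let $(g,\Omega,K,\alpha,\beta)$ be the generalized almost Calabi-Yau structure associated with $(\Omega,\omega)$, i.e. the one built from the normalized form $\omega/\sqrt[4]{|\lambda(\omega)|}$. Then this generalized almost Calabi-Yau structure is integrable (i.e. $d\alpha=0$ and $d\beta=0$) if and only if $$ d\Big(\frac{\omega}{\sqrt[4]{|\lambda(\omega)|}}\Big)=0 \quad\text{and}\quad d\Big(\frac{\hat\omega}{\sqrt[4]{|\lambda(\omega)|}}\Big)=0 . $$
   Context: A Monge-Ampère structure on a $6$-dimensional manifold $X$ is a pair $(\Omega,\omega)\in\Omega^2(X)\times\Omega^3(X)$ with $\Omega$ symplectic and $\omega\wedge\Omega=0$ ($\omega$ is called effective). Put $\theta=-\frac16\Omega^3$. At each point, for a $3$-form $\omega$, the endomorphism $K_\omega$ of the tangent space is defined by $K_\omega(X)\,\theta=A(i_X\omega\wedge\omega)$, where $A:\Lambda^5(V^* )\to V\otimes\Lambda^6(V^* )$ ($V$ the tangent space) is the isomorphism induced by the exterior product; that is, $\xi(K_\omega X)\,\theta=\xi\wedge i_X\omega\wedge\omega$ for all covectors $\xi$. The Hitchin pfaffian is $\lambda(\omega)=\frac16\operatorname{Tr}(K_\omega\circ K_\omega)$. The structure is nondegenerate if $\lambda(\omega)$ vanishes nowhere; in this case $K_\omega^2=\lambda(\omega)\,\mathrm{Id}$ (Hitchin). Decomposition (Hitchin).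 Where $\lambda(\omega)>0$, $\omega=\alpha+\beta$ with $\alpha,\beta$ real decomposable $3$-forms, unique under the requirement $\frac{\alpha\wedge\beta}{\theta}>0$. Where $\lambda(\omega)<0$, $\omega=\alpha+\overline\alpha$ with $\alpha$ a complex decomposable $3$-form, unique under the requirement $\frac{\alpha\wedge\overline\alpha}{i\theta}>0$; in this case one puts $\beta=\overline\alpha$. The dual form is $\hat\omega=\alpha-\beta$ if $\lambda(\omega)>0$, and $\hat\omega=i(\overline\alpha-\alpha)$ if $\lambda(\omega)<0$. A generalized almost Calabi-Yau structure on $X$ is a $5$-tuple $(g,\Omega,K,\alpha,\beta)$ where $g$ is a (pseudo-)Riemannian metric, $\Omega$ is a symplectic form, $K$ is a smooth field of endomorphisms of $TX$ with $K^2=\pm\mathrm{Id}$ and $g(U,V)=\Omega(KU,V)$, and $\alpha,\beta$ are (possibly complex) decomposable $3$-forms whose associated distributions are the distributions of eigenvectors of $K$ and such that $\frac{\alpha\wedge\beta}{\Omega^3}$ is constant. It is integrable if $d\alpha=d\beta=0$. The generalized almost Calabi-Yau structure associated with a nondegenerate Monge-Ampère structure $(\Omega,\omega)$: let $\omega'=\omega/\sqrt[4]{|\lambda(\omega)|}$ (so $\lambda(\omega')=\pm1$); then $K=K_{\omega'}$, $g(U,V)=\Omega(K_{\omega'}U,V)$, and $\alpha,\beta$ are the decomposable $3$-forms in Hitchin's decomposition of $\omega'$: if $\lambda(\omega')=1$, $\alpha,\beta$ are the unique real decomposable $3$-forms with $\omega'=\alpha+\beta$ and $\frac{\alpha\wedge\beta}{\theta}>0$;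 if $\lambda(\omega')=-1$, $\alpha$ is the unique complex decomposable $3$-form with $\omega'=\alpha+\overline\alpha$ and $\frac{\alpha\wedge\overline\alpha}{i\theta}>0$, and $\beta=\overline\alpha$. *)

(* Defs.v *)
From HB Require Import structures.
From mathcomp Require Import all_boot all_order all_algebra all_fingroup.
From mathcomp Require Import all_classical all_reals all_analysis.
From mathcomp Require Import complex.

Set Implicit Arguments.
Unset Strict Implicit.
Unset Printing Implicit Defensive.

Import Order.TTheory GRing.Theory Num.Theory.
Import numFieldNormedType.Exports.

Local Open Scope classical_set_scope.
Local Open Scope ring_scope.
Local Open Scope complex_scope.

(* A k-linear form on R^n with values in F is a function of the (k, n)-matrix
   whose rows are its k arguments. *)
Section MultilinearAlgebra.
Variables (R : realType) (n : nat).

Definition multilinear k (t : 'M[R]_(k, n) -> R) : Prop :=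
  forall (i : 'I_k) (b c : R) (A B C : 'M[R]_(k, n)),
    row i A = b *: row i B + c *: row i C ->
    row' i B = row' i A -> row' i C = row' i A ->
    t A = b * t B + c * t C.

Definition alternating_form k (t : 'M[R]_(k, n) -> R) : Prop :=
  forall (A : 'M[R]_(k, n)) (i j : 'I_k), i != j -> row i A = row j A -> t A = 0.

(* Exterior product with the determinant normalization
   (e_1 ^ ... ^ e_n)(e_1, ..., e_n) = 1. *)
Definition wedge (F : fieldType) p q
    (a : 'M[R]_(p, n) -> F) (b : 'M[R]_(q, n) -> F) (M : 'M[R]_(p + q, n)) : F :=
  (p`! * q`!)%:R^-1 * \sum_(s : 'S_(p + q)) (-1) ^+ s *
    (a (usubmx (row_perm s M)) * b (dsubmx (row_perm s M))).

Definition iprod (F : Type) k (v : 'rV[R]_n) (a : 'M[R]_(1 + k, n) -> F)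
    (M : 'M[R]_(k, n)) : F :=
  a (col_mx v M).

Definition pullback (F : Type) k (J : 'M[R]_n) (a : 'M[R]_(k, n) -> F)
    (M : 'M[R]_(k, n)) : F :=
  a (M *m J).

(* The scalar t / u for top-degree forms t and u != 0. *)
Definition top_ratio (F : fieldType) (t u : 'M[R]_n -> F) : F :=
  t 1%:M / u 1%:M.

Definition to_complex k (a : 'M[R]_(k, n) -> R) (M : 'M[R]_(k, n)) : R[i] :=
  (a M)%:C.

Definition conj_form k (a : 'M[R]_(k, n) -> R[i]) (M : 'M[R]_(k, n)) : R[i] :=
  (a M)^*.

Definition covector (c : 'cV[R]_n) (v : 'rV[R]_n) : R := (v *m c) 0 0.

Definition ccovector (c : 'cV[R[i]]_n) (v : 'rV[R]_n) : R[i] :=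
  (map_mx (real_complex R) v *m c) 0 0.

Definition real_decomposable (a : 'M[R]_(3, n) -> R[i]) : Prop :=
  exists c1 c2 c3 : 'cV[R]_n,
    a =1 to_complex (wedge (covector c1) (wedge (covector c2) (covector c3))).

Definition decomposable (a : 'M[R]_(3, n) -> R[i]) : Prop :=
  exists c1 c2 c3 : 'cV[R[i]]_n,
    a =1 wedge (ccovector c1) (wedge (ccovector c2) (ccovector c3)).

(* Contraction with a complex tangent vector v = Re v + i Im v. *)
Definition ciprod k (v : 'rV[R[i]]_n) (a : 'M[R]_(1 + k, n) -> R[i])
    (M : 'M[R]_(k, n)) : R[i] :=
  iprod (map_mx (@complex.Re R) v) a M
  + 'i * iprod (map_mx (@complex.Im R) v) a M.

End MultilinearAlgebra.

Section Hitchin.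
Variable R : realType.

Definition theta_form (Omega : 'M[R]_(2, 6) -> R) (M : 'M[R]_6) : R :=
  - (6%:R^-1 * wedge Omega (wedge Omega Omega) M).

(* xi(K v) theta = xi ^ i_v omega ^ omega, with xi running over the dual of the
   standard basis. Endomorphisms are matrices acting on row vectors on the
   right. *)
Definition hitchin_map (theta : 'M[R]_6 -> R) (omega : 'M[R]_(3, 6) -> R)
    (v : 'rV[R]_6) : 'rV[R]_6 :=
  \row_j top_ratio
    (wedge (covector (delta_mx j 0)) (wedge (iprod (k := 2) v omega) omega))
    theta.

Definition hitchin_endo (theta : 'M[R]_6 -> R) (omega : 'M[R]_(3, 6) -> R) :
    'M[R]_6 :=
  lin1_mx (hitchin_map theta omega).

Definition hitchin_pfaffian (theta : 'M[R]_6 -> R) (omega : 'M[R]_(3, 6) -> R) :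
    R :=
  6%:R^-1 * \tr (hitchin_endo theta omega *m hitchin_endo theta omega).

(* In R[i], 0 < z means that z is real and positive. *)
Definition hitchin_decomposition (theta : 'M[R]_6 -> R)
    (omega : 'M[R]_(3, 6) -> R) (alpha beta : 'M[R]_(3, 6) -> R[i]) : Prop :=
  (0 < hitchin_pfaffian theta omega ->
     [/\ real_decomposable alpha, real_decomposable beta,
         to_complex omega =1 (fun M => alpha M + beta M) &
         0 < top_ratio (wedge alpha beta) (to_complex theta)]) /\
  (hitchin_pfaffian theta omega < 0 ->
     [/\ decomposable alpha, beta =1 conj_form alpha,
         to_complex omega =1 (fun M => alpha M + conj_form alpha M) &
         0 < top_ratio (wedge alpha (conj_form alpha))
               (fun M => 'i * to_complex theta M)]).

Definition is_dual_form (theta : 'M[R]_6 -> R)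
    (omega omega_hat : 'M[R]_(3, 6) -> R) : Prop :=
  exists alpha beta : 'M[R]_(3, 6) -> R[i],
    [/\ hitchin_decomposition theta omega alpha beta,
        0 < hitchin_pfaffian theta omega ->
          to_complex omega_hat =1 (fun M => alpha M - beta M) &
        hitchin_pfaffian theta omega < 0 ->
          to_complex omega_hat =1
            (fun M => 'i * (conj_form alpha M - alpha M))].

End Hitchin.

Section Smooth.
Variables (R : realType) (n : nat).

Definition iter_derive (s : seq 'rV[R]_n) (f : 'rV[R]_n -> R) : 'rV[R]_n -> R :=
  foldr (fun v (g : 'rV[R]_n -> R) y => 'D_v g y) f s.

(* C^oo on an open set U: all iterated directional derivatives exist and are
   continuous. *)
Definition smooth_on (U : set 'rV[R]_n) (f : 'rV[R]_n -> R) : Prop :=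
  forall (s : seq 'rV[R]_n) (y : 'rV[R]_n), U y ->
    {for y, continuous (iter_derive s f)} /\
    forall v, derivable (iter_derive s f) y v.

End Smooth.

(* Smooth n-manifold, given by an atlas indexed by [chart]: [chart_map i] is a
   homeomorphism from the open set [chart_dom i] onto an open subset of R^n, with
   inverse [chart_inv i]; values outside the domains are irrelevant. *)
Record manifold (R : realType) (n : nat) := Manifold {
  carrier :> topologicalType;
  space_hausdorff : hausdorff_space carrier;
  space_second_countable : @second_countable carrier;
  chart : Type;
  chart_dom : chart -> set carrier;
  chart_map : chart -> carrier -> 'rV[R]_n;
  chart_inv : chart -> 'rV[R]_n -> carrier;
  dom_open : forall i, open (chart_dom i);
  dom_cover : forall x, exists i, chart_dom i x;
  codom_open : forall i, open (chart_map i @` chart_dom i);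
  coordK : forall i, {in chart_dom i, cancel (chart_map i) (chart_inv i)};
  chart_map_continuous : forall i, {within chart_dom i, continuous (chart_map i)};
  chart_inv_continuous : forall i, {within chart_map i @` chart_dom i, continuous (chart_inv i)};
  transition_smooth : forall i j (l : 'I_n),
    smooth_on (chart_map i @` (chart_dom i `&` chart_dom j))
      (fun y => chart_map j (chart_inv i y) 0 l) }.

Section Tensors.
Variables (R : realType) (n : nat) (X : manifold R n).

Definition transition_jacobian (i j : chart X) (x : X) : 'M[R]_n :=
  jacobian (fun y => chart_map j (chart_inv i y)) (chart_map i x).

(* Covariant k-tensor fields are given by their components in each chart:
   [t i x] is t at x read in the coordinates of the chart i, and is meaningful
   only for x in [chart_dom i]. *)
Definition ctensor (F : Type) (k : nat) : Type :=
  chart X -> X -> 'M[R]_(k, n) -> F.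

Definition smooth_tensor k (t : ctensor R k) : Prop :=
  [/\ forall i x, chart_dom i x -> multilinear (t i x),
      forall i j x, chart_dom i x -> chart_dom j x ->
        t i x =1 pullback (transition_jacobian i j x) (t j x) &
      forall i M, smooth_on (chart_map i @` chart_dom i) (fun y => t i (chart_inv i y) M)].

Definition smooth_form k (t : ctensor R k) : Prop :=
  smooth_tensor t /\ forall i x, chart_dom i x -> alternating_form (t i x).

Definition smooth_cform k (t : ctensor R[i] k) : Prop :=
  smooth_form (fun i x M => complex.Re (t i x M)) /\
  smooth_form (fun i x M => complex.Im (t i x M)).

Definition smooth_endo (K : chart X -> X -> 'M[R]_n) : Prop :=
  (forall i j x, chart_dom i x -> chart_dom j x ->
     K i x *m transition_jacobian i j x = transition_jacobian i j x *m K j x) /\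
  (forall i a b, smooth_on (chart_map i @` chart_dom i) (fun y => K i (chart_inv i y) a b)).

(* (d t)(v_0, ..., v_k) = \sum_i (-1)^i D_(v_i) (t(v_0, .., no v_i, .., v_k)),
   for constant vector fields v_0, ..., v_k in the given chart. *)
Definition ext_d k (t : ctensor R k) : ctensor R k.+1 := fun i x M =>
  \sum_(a < k.+1) (-1) ^+ a *
    'D_(row a M) (fun y => t i (chart_inv i y) (row' a M)) (chart_map i x).

Definition ext_dC k (t : ctensor R[i] k) : ctensor R[i] k.+1 := fun i x M =>
  ext_d (fun i x M => complex.Re (t i x M)) i x M
    +i* ext_d (fun i x M => complex.Im (t i x M)) i x M.

Definition closed_form k (t : ctensor R k) : Prop :=
  forall i x, chart_dom i x -> forall M, ext_d t i x M = 0.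

Definition closed_cform k (t : ctensor R[i] k) : Prop :=
  forall i x, chart_dom i x -> forall M, ext_dC t i x M = 0.

Definition nondegenerate_bilinear (t : ctensor R 2) : Prop :=
  forall i x, chart_dom i x -> forall u : 'rV[R]_n,
    (forall v : 'rV[R]_n, t i x (col_mx u v) = 0) -> u = 0.

Definition symplectic_form (t : ctensor R 2) : Prop :=
  [/\ smooth_form t, nondegenerate_bilinear t & closed_form t].

Definition pseudo_riemannian (g : ctensor R 2) : Prop :=
  [/\ smooth_tensor g,
      forall i x, chart_dom i x -> forall u v : 'rV[R]_n,
        g i x (col_mx u v) = g i x (col_mx v u) &
      nondegenerate_bilinear g].

End Tensors.

Section MongeAmpere.
Variables (R : realType) (X : manifold R 6).
Implicit Types (Omega : ctensor X R 2) (omega : ctensor X R 3).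

Definition monge_ampere Omega omega : Prop :=
  [/\ symplectic_form Omega, smooth_form omega &
      forall i x, chart_dom i x -> wedge (omega i x) (Omega i x) =1 (fun=> 0)].

(* Independent of the chart i around x. *)
Definition pfaffian Omega omega (i : chart X) (x : X) : R :=
  hitchin_pfaffian (theta_form (Omega i x)) (omega i x).

Definition nondegenerate_MA Omega omega : Prop :=
  forall i x, chart_dom i x -> pfaffian Omega omega i x != 0.

Definition dual_form Omega omega (omega_hat : ctensor X R 3) : Prop :=
  forall i x, chart_dom i x ->
    is_dual_form (theta_form (Omega i x)) (omega i x) (omega_hat i x).

(* The 3-form t / |lambda(omega)|^(1/4). *)
Definition normalize Omega omega (t : ctensor X R 3) : ctensor X R 3 :=
  fun i x M => t i x M / (`|pfaffian Omega omega i x| `^ 4%:R^-1).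

(* The distribution associated with a decomposable form a is its kernel
   {v | i_v a = 0}; kernels and eigenspaces are taken in the complexified
   tangent space, since for K^2 = - Id the eigenvalues are i and - i.
   The sign in K^2 = +/- Id may change from one connected component of X to
   another, and then so does the constant value of (alpha ^ beta) / Omega^3:
   it is required to be constant locally, hence on each component. *)
Record generalized_almost_CY := GeneralizedAlmostCY {
  acy_g : ctensor X R 2;
  acy_Omega : ctensor X R 2;
  acy_K : chart X -> X -> 'M[R]_6;
  acy_alpha : ctensor X R[i] 3;
  acy_beta : ctensor X R[i] 3;
  acy_g_metric : pseudo_riemannian acy_g;
  acy_Omega_symplectic : symplectic_form acy_Omega;
  acy_K_smooth : smooth_endo acy_K;
  acy_K_square : forall i x, chart_dom i x ->
    acy_K i x *m acy_K i x = 1%:M \/ acy_K i x *m acy_K i x = - 1%:M;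
  acy_gE : forall i x, chart_dom i x -> forall u v : 'rV[R]_6,
    acy_g i x (col_mx u v) = acy_Omega i x (col_mx (u *m acy_K i x) v);
  acy_alpha_form : smooth_cform acy_alpha;
  acy_beta_form : smooth_cform acy_beta;
  acy_alpha_decomposable : forall i x, chart_dom i x -> decomposable (acy_alpha i x);
  acy_beta_decomposable : forall i x, chart_dom i x -> decomposable (acy_beta i x);
  acy_distributions : forall i x, chart_dom i x ->
    exists e : R[i], forall v : 'rV[R[i]]_6,
      (ciprod (k := 2) v (acy_alpha i x) =1 (fun=> 0) <->
         v *m map_mx (real_complex R) (acy_K i x) = e *: v) /\
      (ciprod (k := 2) v (acy_beta i x) =1 (fun=> 0) <->
         v *m map_mx (real_complex R) (acy_K i x) = - e *: v);
  acy_constant : forall i x, chart_dom i x -> \forall y \near x,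
    let ratio z := top_ratio (wedge (acy_alpha i z) (acy_beta i z))
      (to_complex
        (wedge (acy_Omega i z) (wedge (acy_Omega i z) (acy_Omega i z)))) in
    ratio y = ratio x }.

Definition integrable_acy (S : generalized_almost_CY) : Prop :=
  closed_cform (acy_alpha S) /\ closed_cform (acy_beta S).

Definition associated_acy Omega omega (S : generalized_almost_CY) : Prop :=
  let omega' := normalize Omega omega omega in
  forall i x, chart_dom i x ->
    let K := hitchin_endo (theta_form (Omega i x)) (omega' i x) in
    [/\ acy_Omega S i x =1 Omega i x,
        acy_K S i x = K,
        forall u v : 'rV[R]_6,
          acy_g S i x (col_mx u v) = Omega i x (col_mx (u *m K) v) &
        hitchin_decomposition (theta_form (Omega i x)) (omega' i x)
          (acy_alpha S i x) (acy_beta S i x)].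

End MongeAmpere.

(* Main.v *)
Require Import Defs.
From mathcomp Require Import all_boot all_order all_algebra all_fingroup.
From mathcomp Require Import all_classical all_reals all_analysis.
From mathcomp Require Import complex ring lra.

Set Implicit Arguments.
Unset Strict Implicit.
Unset Printing Implicit Defensive.

Import Order.TTheory GRing.Theory Num.Theory.
Import numFieldNormedType.Exports.

Local Open Scope classical_set_scope.
Local Open Scope ring_scope.
Local Open Scope complex_scope.

(* If [omega = alpha + beta] with [alpha], [beta] decomposable, then [K_omega]
   multiplies the covectors of [alpha] by [c = (alpha ^ beta) / theta] and those
   of [beta] by [- c], so that contracting [omega] with [K_omega] in one argument
   gives [c (alpha - beta)]. Two decompositions thus have proportional
   differences, and [omega ^ (alpha - beta) = -2 alpha ^ beta] together with the
   sign condition makes the factor 1: the decomposition is unique. Hence the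
   normalized [omega] and its dual are [alpha + beta] and [alpha - beta] where
   [lambda > 0], and [2 Re alpha] and [2 Im alpha] where [lambda < 0]. The sign
   of [lambda] being locally constant, these linear relations persist after
   exterior differentiation, and they are invertible. *)

(** * Exterior products of determinant forms *)

Section BlockPermutation.
Variables (p q : nat) (t : 'S_p) (u : 'S_q).

Definition block_perm_fun (k : 'I_(p + q)) : 'I_(p + q) :=
  match fintype.split k with inl i => lshift q (t i) | inr j => rshift p (u j) end.

Lemma block_perm_inj : injective block_perm_fun.
Proof.
move=> k l; rewrite /block_perm_fun.
case: (split_ordP k) => i ->; case: (split_ordP l) => j -> /eqP.
- by rewrite eq_lshift => /eqP /perm_inj ->.
- by rewrite eq_lrshift.
- by rewrite eq_rlshift.
- by rewrite eq_rshift => /eqP /perm_inj ->.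
Qed.

Definition block_perm : 'S_(p + q) := perm block_perm_inj.

Lemma block_perm_lshift i : block_perm (lshift q i) = lshift q (t i).
Proof. by rewrite permE /block_perm_fun (unsplitK (inl i)). Qed.

Lemma block_perm_rshift j : block_perm (rshift p j) = rshift p (u j).
Proof. by rewrite permE /block_perm_fun (unsplitK (inr j)). Qed.

Lemma sign_block_perm (F : comNzRingType) :
  (-1) ^+ block_perm = (-1) ^+ t * (-1) ^+ u :> F.
Proof.
(* The signature is the determinant of the permutation matrix, which is block diagonal here. *)
rewrite -!det_perm -(det_lblock _ 0); congr (\det _); apply/matrixP => k l.
case: (split_ordP k) => i ->; case: (split_ordP l) => j ->.
- by rewrite block_mxEul !mxE block_perm_lshift eq_lshift.
- by rewrite block_mxEur !mxE block_perm_lshift eq_lrshift.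
- by rewrite block_mxEdl !mxE block_perm_rshift eq_rlshift.
- by rewrite block_mxEdr !mxE block_perm_rshift eq_rshift.
Qed.

End BlockPermutation.

(* The Laplace expansion along the first p columns, the sum over p-subsets of
   rows being replaced by a sum over all permutations of the rows. *)
Lemma sum_det_blocks (F : comNzRingType) p q (P : 'M[F]_(p + q)) :
  \sum_(s : 'S_(p + q)) (-1) ^+ s *
    (\det (ulsubmx (row_perm s P)) * \det (drsubmx (row_perm s P)))
  = (p`! * q`!)%:R * \det P.
Proof.
(* Expand both minors by Leibniz and sum over [s] first. Each [T t u] is then the Leibniz formula
   for [P] with permuted columns, whose sign cancels, so all [p! q!] of them equal [\det P]. *)
pose T t u := \sum_(s : 'S_(p + q)) (-1) ^+ s * ((-1) ^+ block_perm t u *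
  \prod_k P (s k) (block_perm t u k)).
transitivity (\sum_(t : 'S_p) \sum_(u : 'S_q) T t u).
  under [RHS]eq_bigr do rewrite exchange_big.
  rewrite exchange_big; apply: eq_bigr => s _ /=.
  rewrite mulr_suml mulr_sumr; apply: eq_bigr => t _ /=.
  rewrite !mulr_sumr; apply: eq_bigr => u _ /=; congr (_ * _).
  rewrite sign_block_perm big_split_ord /= mulrACA; congr (_ * (_ * _)).
    by apply: eq_bigr => i _; rewrite block_perm_lshift !mxE.
  by apply: eq_bigr => i _; rewrite block_perm_rshift !mxE.
have TE t u : T t u = \det P.
  transitivity ((-1) ^+ block_perm t u * \det (col_perm (block_perm t u) P)^T).
    rewrite mulr_sumr; apply: eq_bigr => s _ /=.
    rewrite mulrCA; congr (_ * (_ * _)).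
    by apply: eq_bigr => k _; rewrite !mxE.
  rewrite det_tr col_permE det_mulmx det_perm odd_permV mulrCA -signr_addb.
  by rewrite addbb mulr1.
under eq_bigr do under eq_bigr do rewrite TE.
by rewrite !sumr_const !card_Sn -mulrnA mulr_natl mulnC.
Qed.

Section DeterminantForms.
Variables (R : realType) (n : nat) (F : numFieldType) (f : {rmorphism R -> F}).
Local Notation cmx := (map_mx f).

(** The exterior product of the covectors given by the columns of [A]: decomposable forms become
    determinants. *)
Definition det_form p (A : 'M[F]_(n, p)) (M : 'M[R]_(p, n)) : F :=
  \det (cmx M *m A).

(** The permutation sum defining the product is the Laplace sum of [sum_det_blocks], whose factor
    [p! q!] cancels the normalization. *)
Lemma wedge_det_form p q (A : 'M[F]_(n, p)) (B : 'M[F]_(n, q)) :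
  wedge (det_form A) (det_form B) = det_form (row_mx A B).
Proof.
apply/funext => M; rewrite /wedge /det_form.
set P := cmx M *m row_mx A B.
have nz : (p`! * q`!)%:R != 0 :> F by rewrite pnatr_eq0 -lt0n muln_gt0 !fact_gt0.
apply: (mulfI nz); rewrite (mulVKf nz) -sum_det_blocks.
apply: eq_bigr => s _; congr (_ * _).
have -> : row_perm s P = cmx (row_perm s M) *m row_mx A B.
  by rewrite map_row_perm !row_permE mulmxA.
by rewrite /ulsubmx /drsubmx -mul_usub_mx -mul_dsub_mx !mul_mx_row row_mxKl
  row_mxKr map_usubmx map_dsubmx.
Qed.

Lemma wedgeDl p q (a a' : 'M[R]_(p, n) -> F) (b : 'M[R]_(q, n) -> F) :
  wedge (a \+ a' : _ -> F) b = (wedge a b \+ wedge a' b : _ -> F).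
Proof.
apply/funext => M; rewrite /wedge /= -mulrDr -big_split /=; congr (_ * _).
by apply: eq_bigr => s _; rewrite mulrDl mulrDr.
Qed.

Lemma wedgeDr p q (a : 'M[R]_(p, n) -> F) (b b' : 'M[R]_(q, n) -> F) :
  wedge a (b \+ b' : _ -> F) = (wedge a b \+ wedge a b' : _ -> F).
Proof.
apply/funext => M; rewrite /wedge /= -mulrDr -big_split /=; congr (_ * _).
by apply: eq_bigr => s _; rewrite !mulrDr.
Qed.

Lemma wedgeZl p q c (a : 'M[R]_(p, n) -> F) (b : 'M[R]_(q, n) -> F) :
  wedge (c \*o a : _ -> F) b = (c \*o wedge a b : _ -> F).
Proof.
apply/funext => M; rewrite /wedge /= [RHS]mulrCA; congr (_ * _).
rewrite mulr_sumr; apply: eq_bigr => s _.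
by rewrite -mulrA mulrCA.
Qed.

Lemma wedgeZr p q c (a : 'M[R]_(p, n) -> F) (b : 'M[R]_(q, n) -> F) :
  wedge a (c \*o b : _ -> F) = (c \*o wedge a b : _ -> F).
Proof.
apply/funext => M; rewrite /wedge /= [RHS]mulrCA; congr (_ * _).
rewrite mulr_sumr; apply: eq_bigr => s _.
by rewrite [RHS]mulrCA; congr (_ * _); exact: mulrCA.
Qed.

Lemma wedge_map p q (a : 'M[R]_(p, n) -> R) (b : 'M[R]_(q, n) -> R) :
  f \o wedge a b = wedge (f \o a) (f \o b).
Proof.
apply/funext => M; rewrite /wedge /= rmorphM fmorphV rmorph_nat rmorph_sum.
congr (_ * _); apply: eq_bigr => s _.
by rewrite !rmorphM rmorph_sign.
Qed.

Lemma wedge_suml m p q c (a : 'I_m -> 'M[R]_(p, n) -> F) (b : 'M[R]_(q, n) -> F) M :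
  wedge (fun N => \sum_j c j * a j N) b M = \sum_j c j * wedge (a j) b M.
Proof.
rewrite /wedge; under [RHS]eq_bigr do rewrite mulrCA mulr_sumr.
rewrite -mulr_sumr exchange_big; congr (_ * _); apply: eq_bigr => s _ /=.
rewrite mulr_suml mulr_sumr; apply: eq_bigr => j _.
by rewrite -mulrA mulrCA.
Qed.

Lemma wedge_sumr m p q c (a : 'M[R]_(p, n) -> F) (b : 'I_m -> 'M[R]_(q, n) -> F) M :
  wedge a (fun N => \sum_j c j * b j N) M = \sum_j c j * wedge a (b j) M.
Proof.
rewrite /wedge; under [RHS]eq_bigr do rewrite mulrCA mulr_sumr.
rewrite -mulr_sumr exchange_big; congr (_ * _); apply: eq_bigr => s _ /=.
rewrite mulr_sumr mulr_sumr; apply: eq_bigr => j _.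
by rewrite [RHS]mulrCA; congr (_ * _); exact: mulrCA.
Qed.

(** Expansion of the determinant along its first row, which holds the contracting vector. *)
Lemma iprod_det_form k (u : 'rV[R]_n) (A : 'M[F]_(n, 1 + k)) (M : 'M[R]_(k, n)) :
  iprod u (det_form A) M =
  \sum_(j < 1 + k) ((-1) ^+ j * (cmx u *m A) 0 j) * det_form (col' j A) M.
Proof.
rewrite /iprod /det_form map_col_mx mul_col_mx (expand_det_row _ (lshift k 0)).
apply: eq_bigr => j _; rewrite col_mxEu /cofactor add0n mulrCA mulrA.
congr (_ * \det _); apply/matrixP => a b; rewrite !mxE.
have -> : lift (lshift k 0) a = rshift 1 a by exact: val_inj.
by rewrite (unsplitK (inr a)) mxE; apply: eq_bigr => l _; rewrite !mxE.
Qed.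

Lemma wedge_iprod_det_form k q (u : 'rV[R]_n) (x : 'cV[F]_n)
    (A : 'M[F]_(n, 1 + k)) (B : 'M[F]_(n, q)) M :
  wedge (det_form x) (wedge (iprod u (det_form A)) (det_form B)) M =
  \sum_(j < 1 + k) ((-1) ^+ j * (cmx u *m A) 0 j) *
    det_form (row_mx x (row_mx (col' j A) B)) M.
Proof.
rewrite (funext (iprod_det_form u A)) (funext (wedge_suml _ _ _)) wedge_sumr.
by apply: eq_bigr => j _; rewrite !wedge_det_form.
Qed.

Lemma det_form_repeated_col p q (x : 'cV[F]_n) (A : 'M[F]_(n, p))
    (B : 'M[F]_(n, q)) i j M :
  col i A = col j B -> det_form (row_mx x (row_mx A B)) M = 0.
Proof.
move=> eqAB; rewrite /det_form -det_tr.
rewrite (@determinant_alternate _ _ _ (rshift 1 (lshift q i))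
  (rshift 1 (rshift p j))) //; first by rewrite !eq_rshift eq_lrshift.
move=> a; do 2!rewrite [LHS]mxE [RHS]mxE.
apply: eq_bigr => l _; rewrite !row_mxEr row_mxEl; congr (_ * _).
by move/matrixP: eqAB => /(_ l 0); rewrite !mxE.
Qed.

(** [A] has at least two columns, so [col' j A] keeps one that occurs again in the last factor:
    every term of the expansion has a repeated column. *)
Lemma wedge_iprod_det_form_id k (u : 'rV[R]_n) (x : 'cV[F]_n)
    (A : 'M[F]_(n, 1 + k.+1)) M :
  wedge (det_form x) (wedge (iprod u (det_form A)) (det_form A)) M = 0.
Proof.
rewrite wedge_iprod_det_form big1 // => j _.
rewrite (@det_form_repeated_col k.+1 _ x (col' j A) A 0 (lift j 0)) ?mulr0 //.
by apply/matrixP => a b; rewrite !mxE.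
Qed.

End DeterminantForms.

(** Cramer's rule, with the replacing column moved to the front at the cost of the sign. *)
Lemma det_col_replace (F : comNzRingType) m (P : 'M[F]_(1 + m)) (x : 'cV[F]_(1 + m))
    (j : 'I_(1 + m)) :
  (-1) ^+ j * \det (row_mx x (col' j P)) = (\adj P *m x) j 0.
Proof.
rewrite (expand_det_col _ (lshift m 0)) mulr_sumr mxE; apply: eq_bigr => i _.
rewrite row_mxEl mxE mulrCA mulrC; congr (_ * _).
rewrite /cofactor mulrA -exprD addn0 addnC; congr (_ * \det _).
apply/matrixP => a b; rewrite !mxE.
have -> : lift (lshift m 0) b = rshift 1 b by exact: val_inj.
by rewrite (unsplitK (inr b)) mxE.
Qed.

(** Cramer's rule collects the expansion of the contraction into one adjugate. The zero block
    discards the columns of [B], since only the form of [A] is contracted. *)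
Lemma wedge_iprod_adj (R : realType) (F : numFieldType) (f : {rmorphism R -> F})
    k q (u : 'rV[R]_(1 + k + q)) (x : 'cV[F]_(1 + k + q))
    (A : 'M[F]_(1 + k + q, 1 + k)) (B : 'M[F]_(1 + k + q, q)) :
  wedge (det_form f x) (wedge (iprod u (det_form f A)) (det_form f B))
    (1%:M : 'M[R]_(1 + k + q)) =
  (map_mx f u *m row_mx A 0 *m \adj (row_mx A B) *m x) 0 0.
Proof.
rewrite wedge_iprod_det_form -mulmxA mxE [RHS]big_split_ord.
rewrite [X in _ = _ + X]big1 /= ?addr0.
  apply: eq_bigr => j _; rewrite mul_mx_row row_mxEl mulrAC mulrC.
  congr (_ * _); rewrite /det_form map_mx1 mul1mx.
  rewrite -(det_col_replace (row_mx A B) x (lshift q j)).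
  by rewrite (@col'Kl _ _ k q j A B).
by move=> j _; rewrite mul_mx_row row_mxEr mulmx0 mxE mul0r.
Qed.

(** * Uniqueness of the Hitchin decomposition *)

(** When the determinant is nonzero, [row_mx A 0 *m \adj (row_mx A B)] is, up to that factor, the
    projection onto the columns of [A] along those of [B]. *)
Lemma mul_adj_row_mx (F : comNzRingType) p q (A : 'M[F]_(p + q, p))
    (B : 'M[F]_(p + q, q)) :
  row_mx A 0 *m \adj (row_mx A B) *m A = \det (row_mx A B) *: A /\
  row_mx A 0 *m \adj (row_mx A B) *m B = 0.
Proof.
have := mul_adj_mx (row_mx A B).
rewrite mul_mx_row scalar_mx_block block_mxEh => /eq_row_mx [eA eB].
rewrite -!mulmxA eA eB !mul_row_col !mul0mx !addr0 mulmx0.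
by rewrite mul_mx_scalar.
Qed.

Lemma det_row_mxC (F : comNzRingType) q (A B : 'M[F]_(q + q, q)) :
  \det (row_mx B A) = (-1) ^+ q * \det (row_mx A B).
Proof.
(* [U *m L *m U] is a quarter turn written as a product of shears of determinant 1; it takes
   [row_mx A B] to [row_mx (- B) A]. *)
pose U := block_mx 1%:M 1%:M 0 1%:M : 'M[F]_(q + q).
pose L := block_mx 1%:M 0 (- 1%:M) 1%:M : 'M[F]_(q + q).
have rotE : row_mx A B *m (U *m L *m U) =
    row_mx B A *m block_mx (- 1%:M) 0 0 1%:M.
  rewrite !mulmx_block !mul_row_block !(mulmx0, mul0mx, mulmx1, mul1mx).
  rewrite !(mulNmx, mulmxN, mul0mx, mulmx0, mulmx1, mul1mx, addr0, add0r, oppr0).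
  by rewrite subrr addNr add0r !mulmx0 mulmx1 add0r addr0.
have := congr1 determinant rotE.
rewrite !det_mulmx !det_ublock !det_lblock !det1 !mulr1 => ->.
by rewrite -scaleN1r detZ det1 mulr1 mulrCA -expr2 sqrr_sign mulr1.
Qed.

Section HitchinDeterminant.
Variables (R : realType) (F : numFieldType) (f : {rmorphism R -> F}).
Variables (theta : 'M[R]_6 -> R) (omega : 'M[R]_(3, 6) -> R).
Local Notation cmx := (map_mx f).
Local Notation K := (hitchin_endo theta omega).

(** For [omega = alpha + beta], the terms [i_u alpha ^ alpha] and [i_u beta ^ beta] of
    [i_u omega ^ omega] contribute nothing; the two cross terms are adjugates. *)
Lemma map_hitchin_endo (A B : 'M[F]_(6, 3)) :
  f \o omega = det_form f A \+ det_form f B ->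
  cmx K = (f (theta 1%:M))^-1 *:
    (row_mx A 0 *m \adj (row_mx A B) + row_mx B 0 *m \adj (row_mx B A)).
Proof.
move=> omegaE; apply/matrixP => i j.
rewrite [LHS]mxE [RHS]mxE [hitchin_endo _ _ _ _]mxE
   [hitchin_map _ _ _ _ _]mxE.
rewrite /top_ratio fmorph_div mulrC; congr (_ * _).
set u := delta_mx 0 i.
set w := wedge _ _; rewrite -[f (w _)]/((f \o w) _) /w !wedge_map.
rewrite -[f \o iprod u omega]/(iprod u (f \o omega)) omegaE.
rewrite -[iprod u _]/(iprod u (det_form f A) \+ iprod u (det_form f B)).
have -> : f \o covector (delta_mx j 0) = det_form f (delta_mx j 0).
  apply/funext => v; rewrite /covector /det_form /= det_mx11.
  by rewrite -(map_delta_mx f) -map_mxM [RHS]mxE.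
rewrite [wedge (iprod u _ \+ _) _]wedgeDl !wedgeDr /=.
rewrite !wedge_iprod_det_form_id add0r addr0 addrC.
have entryE (Y : 'M[F]_6) : (cmx u *m Y *m (delta_mx j 0 : 'cV_6)) 0 0 = Y i j.
  by rewrite /u map_delta_mx -rowE -colE !mxE.
have crossE (A' B' : 'M[F]_(6, 3)) : wedge (det_form f (delta_mx j 0 : 'cV_6))
    (wedge (iprod (k := 2) u (det_form f A')) (det_form f B')) (1%:M : 'M[R]_6) =
    (row_mx A' 0 *m \adj (row_mx A' B')) i j.
  rewrite -(entryE (row_mx A' 0 *m _)) mulmxA.
  exact: (@wedge_iprod_adj _ _ f 2 3).
by rewrite [RHS]mxE addrC !crossE.
Qed.

(** Both summands of [K] act as multiples of complementary projections; the multiples are opposite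
    because exchanging two blocks of odd width 3 changes the sign of the determinant. *)
Lemma hitchin_endo_eigen (A B : 'M[F]_(6, 3)) :
  f \o omega = det_form f A \+ det_form f B ->
  let c := \det (row_mx A B) / f (theta 1%:M) in
  cmx K *m A = c *: A /\ cmx K *m B = - c *: B.
Proof.
move=> omegaE c; rewrite (map_hitchin_endo omegaE) -!scalemxAl !mulmxDl.
have [AA AB] := @mul_adj_row_mx _ 3 3 A B.
have [BB BA] := @mul_adj_row_mx _ 3 3 B A.
rewrite AA AB BB BA addr0 add0r (@det_row_mxC _ 3 A B) -signr_odd /= expr1 mulN1r.
by rewrite !scalerA mulrN mulrC.
Qed.

End HitchinDeterminant.

Lemma det_form_eigen (R : realType) (F : numFieldType) (f : {rmorphism R -> F})
    n k (A : 'M[F]_(n, 1 + k)) (L : 'M[R]_n) c u (N : 'M[R]_(k, n)) :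
  map_mx f L *m A = c *: A ->
  det_form f A (col_mx (u *m L) N) = c * det_form f A (col_mx u N).
Proof.
move=> eigA; rewrite /det_form !map_col_mx !mul_col_mx map_mxM -mulmxA eigA.
rewrite -scalemxAr -mul_scalar_mx.
have -> : col_mx (c%:M *m (map_mx f u *m A)) (map_mx f N *m A) =
    block_mx c%:M 0 0 1%:M *m col_mx (map_mx f u *m A) (map_mx f N *m A).
  by rewrite mul_block_col !mul0mx mul1mx addr0 add0r.
by rewrite det_mulmx det_ublock det1 mulr1 det_scalar1.
Qed.

Section DecompositionUniqueness.
Variables (R : realType) (F : numFieldType) (f : {rmorphism R -> F}).
Variable omega : 'M[R]_(3, 6) -> R.

(* Contracting omega with its Hitchin endomorphism K gives
   (alpha ^ beta) (alpha - beta). *)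
Lemma dual_form_proportional (A B A' B' : 'M[F]_(6, 3)) (M : 'M[R]_(3, 6)) :
  f \o omega = det_form f A \+ det_form f B ->
  f \o omega = det_form f A' \+ det_form f B' ->
  \det (row_mx A B) * (det_form f A M - det_form f B M) =
  \det (row_mx A' B') * (det_form f A' M - det_form f B' M).
Proof.
(* The volume form is taken to be the determinant, with value 1 on the standard basis, so that the
   eigenvalues are exactly the determinants in the statement. *)
pose K := hitchin_endo (@determinant R 6) omega.
set M' : 'M[R]_(1 + 2, 6) := M.
have contract C D : f \o omega = det_form f C \+ det_form f D ->
    f (omega (col_mx (usubmx M' *m K) (dsubmx M'))) =
    \det (row_mx C D) * (det_form f C M - det_form f D M).
  move=> omegaE; have [] := hitchin_endo_eigen (@determinant R 6) omegaE.
  rewrite det1 rmorph1 divr1 => eC eD.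
  rewrite -[LHS]/((f \o omega) _) omegaE /=.
  rewrite (@det_form_eigen _ _ f _ 2 _ _ _ _ _ eC).
  rewrite (@det_form_eigen _ _ f _ 2 _ _ _ _ _ eD).
  by rewrite vsubmxK mulNr -mulrBr.
by move=> /contract <- /contract <-.
Qed.

Lemma wedge_dual (A B : 'M[F]_(6, 3)) :
  wedge (det_form f A \+ det_form f B) (det_form f A \+ (-1) \*o det_form f B)
    (1%:M : 'M[R]_6) = - 2 * \det (row_mx A B).
Proof.
rewrite wedgeDl !wedgeDr !wedgeZr !wedge_det_form /=.
have det1E (P : 'M[F]_6) : det_form f P 1%:M = \det P.
  by rewrite /det_form map_mx1 mul1mx.
have detAA (C : 'M[F]_(6, 3)) : \det (row_mx C C) = 0.
  have := @det_row_mxC _ 3 C C; rewrite -signr_odd /= expr1 mulN1r => /esym/eqP.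
  by rewrite eqNr => /eqP.
rewrite !det1E !detAA (@det_row_mxC _ 3 A B) -signr_odd /=; ring.
Qed.

Lemma decomposition_unique (A B A' B' : 'M[F]_(6, 3)) (r : F) :
  f \o omega = det_form f A \+ det_form f B ->
  f \o omega = det_form f A' \+ det_form f B' ->
  \det (row_mx A B) != 0 -> 0 < r ->
  \det (row_mx A' B') = r * \det (row_mx A B) ->
  det_form f A = det_form f A' /\ det_form f B = det_form f B'.
Proof.
move=> e e' nz r0 dr.
have dE : det_form f A \+ (-1) \*o det_form f B =
    r \*o (det_form f A' \+ (-1) \*o det_form f B').
  apply/funext => M /=; rewrite !mulN1r; apply: (mulfI nz).
  by rewrite (dual_form_proportional M e e') dr mulrA [_ * r]mulrC.
(* Wedging [dE] with [omega] and using [wedge_dual] on both sides gives [r ^+ 2 = 1]; positivity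
   excludes [-1]. *)
have r1 : r = 1.
  have := wedge_dual A B; rewrite dE wedgeZr -e e' /= wedge_dual dr.
  have nz2 : - 2 * \det (row_mx A B) != 0 by rewrite mulf_neq0 // oppr_eq0 pnatr_eq0.
  move=> h.
  have : (r ^+ 2) * (- 2 * \det (row_mx A B)) = 1 * (- 2 * \det (row_mx A B)).
    by rewrite mul1r -[RHS]h; ring.
  move/(mulIf nz2)/eqP; rewrite sqrf_eq1 => /orP[/eqP //|/eqP r1].
  by move: r0; rewrite r1 ltr0N1.
have sumE M : det_form f A M + det_form f B M = det_form f A' M + det_form f B' M.
  by move: (congr1 (@^~ M) e) (congr1 (@^~ M) e') => /= <- <-.
have difE M : det_form f A M - det_form f B M = det_form f A' M - det_form f B' M.
  by move: (congr1 (@^~ M) dE) => /=; rewrite r1 !mulN1r mul1r.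
have nz2 : 2 != 0 :> F by rewrite pnatr_eq0.
split; apply/funext => M; apply: (mulfI nz2).
  transitivity ((det_form f A M + det_form f B M) +
                (det_form f A M - det_form f B M)).
    by ring.
  by rewrite sumE difE; ring.
transitivity ((det_form f A M + det_form f B M) -
              (det_form f A M - det_form f B M)).
  by ring.
by rewrite sumE difE; ring.
Qed.

End DecompositionUniqueness.

(** Lets both signs of the pfaffian share one uniqueness argument over [R[i]]. *)
Lemma real_decomposable_decomposable (R : realType) n (a : 'M[R]_(3, n) -> R[i]) :
  real_decomposable a -> decomposable a.
Proof.
case=> c1 [c2 [c3 aE]].
exists (map_mx (real_complex R) c1), (map_mx (real_complex R) c2),
  (map_mx (real_complex R) c3).
have covectorE (c : 'cV[R]_n) :
    ccovector (map_mx (real_complex R) c) = real_complex R \o covector c.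
  by apply/funext => v; rewrite /ccovector /covector -map_mxM mxE.
by rewrite !covectorE -!wedge_map => M; rewrite aE.
Qed.

Lemma decomposable_det_form (R : realType) n (a : 'M[R]_(3, n) -> R[i]) :
  decomposable a -> exists A : 'M[R[i]]_(n, 3), a = det_form (real_complex R) A.
Proof.
case=> c1 [c2 [c3 /funext ->]]; exists (row_mx c1 (row_mx c2 c3)).
have covectorE (c : 'cV[R[i]]_n) : ccovector c = det_form (real_complex R) c.
  by apply/funext => v; rewrite /ccovector /det_form det_mx11.
by rewrite !covectorE !wedge_det_form.
Qed.

Section HitchinDecomposition.
Variables (R : realType) (theta : 'M[R]_6 -> R).
Implicit Types (omega : 'M[R]_(3, 6) -> R) (alpha beta : 'M[R]_(3, 6) -> R[i]).

Lemma conj_det_form (A : 'M[R[i]]_(6, 3)) :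
  conj_form (det_form (real_complex R) A) =
    det_form (real_complex R) (map_mx conjc A).
Proof.
apply/funext => M; rewrite /conj_form /det_form -[LHS](det_map_mx conjc) map_mxM.
congr (\det (_ *m _)); apply/matrixP => i j; rewrite !mxE; exact: conjc_real.
Qed.

(** [tau] is [theta] for a positive pfaffian and ['i * theta] for a negative one. The quotient of
    the two positive ratios is the [r] of [decomposition_unique]. *)
Lemma top_ratio_unique omega (tau : 'M[R]_6 -> R[i]) (A B A' B' : 'M[R[i]]_(6, 3)) :
  let form := det_form (real_complex R) in
  real_complex R \o omega = form 3 A \+ form 3 B ->
  real_complex R \o omega = form 3 A' \+ form 3 B' ->
  0 < top_ratio (wedge (form 3 A) (form 3 B)) tau ->
  0 < top_ratio (wedge (form 3 A') (form 3 B')) tau ->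
  form 3 A = form 3 A' /\ form 3 B = form 3 B'.
Proof.
move=> form e e'; rewrite /top_ratio !wedge_det_form.
have det1E (P : 'M[R[i]]_6) : det_form (real_complex R) P 1%:M = \det P.
  by rewrite /det_form map_mx1 mul1mx.
rewrite !det1E => d_gt0 d'_gt0.
have nz : \det (row_mx A B) != 0.
  by apply/eqP => d0; move: d_gt0; rewrite d0 mul0r ltxx.
(* Since [x / 0 = 0], a positive ratio forces a nonzero denominator. *)
have nz_tau : tau 1%:M != 0.
  by apply/eqP => t0; move: d_gt0; rewrite t0 invr0 mulr0 ltxx.
apply: (decomposition_unique e e' nz (divr_gt0 d'_gt0 d_gt0)).
by field; rewrite nz nz_tau.
Qed.

Lemma hitchin_decomposition_unique omega alpha beta alpha' beta' :
  hitchin_pfaffian theta omega != 0 ->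
  hitchin_decomposition theta omega alpha beta ->
  hitchin_decomposition theta omega alpha' beta' ->
  alpha = alpha' /\ beta = beta'.
Proof.
rewrite neq_lt => /orP[lt0|gt0] [pos neg] [pos' neg'].
  case: (neg lt0) => /decomposable_det_form[A ->] /funext -> /funext.
  case: (neg' lt0) => /decomposable_det_form[A' ->] /funext -> /funext.
  by rewrite !conj_det_form => e' r' e r; exact: top_ratio_unique e e' r r'.
case: (pos gt0) => /real_decomposable_decomposable/decomposable_det_form[A ->].
move=> /real_decomposable_decomposable/decomposable_det_form[B ->] /funext e r.
case: (pos' gt0) => /real_decomposable_decomposable/decomposable_det_form[A' ->].
move=> /real_decomposable_decomposable/decomposable_det_form[B' ->] /funext e' r'.
exact: top_ratio_unique e e' r r'.
Qed.

(** [K] is quadratic in [omega], and the pfaffian is quadratic in [K]. *)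
Lemma hitchin_pfaffianZ k omega :
  hitchin_pfaffian theta (k \*o omega) = k ^+ 4 * hitchin_pfaffian theta omega.
Proof.
have endoZ : hitchin_endo theta (k \*o omega) = k ^+ 2 *: hitchin_endo theta omega.
  apply/matrixP => i j; rewrite [LHS]mxE [RHS]mxE [hitchin_endo _ _ _ _]mxE.
  rewrite ![hitchin_map _ _ _ _ _]mxE /top_ratio.
  rewrite -[iprod _ (k \*o omega)]/(k \*o iprod (delta_mx 0 i) omega).
  by rewrite (wedgeZl k) !(wedgeZr k) /= !mulrA expr2.
rewrite /hitchin_pfaffian endoZ -scalemxAl -scalemxAr scalerA mxtraceZ.
by rewrite mulrCA -exprD.
Qed.

Lemma real_decomposableZ k alpha :
  real_decomposable alpha -> real_decomposable (k%:C \*o alpha).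
Proof.
case=> c1 [c2 [c3 aE]]; exists (k *: c1), c2, c3 => M.
have -> : covector (k *: c1) = k \*o covector c1.
  by apply/funext => v; rewrite /covector -scalemxAr mxE.
by rewrite (wedgeZl k) -[LHS]/(k%:C * alpha M) aE /to_complex -rmorphM.
Qed.

Lemma decomposableZ k alpha :
  decomposable alpha -> decomposable (k \*o alpha).
Proof.
case=> c1 [c2 [c3 aE]]; exists (k *: c1), c2, c3 => M.
have -> : ccovector (k *: c1) = k \*o ccovector c1.
  by apply/funext => v; rewrite /ccovector -scalemxAr mxE.
by rewrite (wedgeZl k) -[LHS]/(k * alpha M) aE.
Qed.

Lemma conj_formZ k alpha : conj_form (k%:C \*o alpha) = k%:C \*o conj_form alpha.
Proof.
apply/funext => M; rewrite /conj_form /= rmorphM; congr (_ * _).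
exact: conjc_real.
Qed.

Lemma top_ratio_wedgeZ k (tau : 'M[R]_6 -> R[i]) alpha beta :
  0 < k -> 0 < top_ratio (wedge alpha beta) tau ->
  0 < top_ratio (wedge (k%:C \*o alpha) (k%:C \*o beta)) tau.
Proof.
move=> k_gt0 r_gt0; have kC_gt0 : 0 < k%:C by rewrite ltcR.
rewrite (wedgeZl k%:C) (wedgeZr k%:C) /top_ratio.
rewrite -[X in X / _]/(k%:C * (k%:C * wedge alpha beta 1%:M)) -mulrA.
by rewrite pmulr_rgt0 // -mulrA pmulr_rgt0.
Qed.

(** The dual form refers to a decomposition of [omega], the associated structure to one of the
    normalized form; this passes between them. *)
Lemma hitchin_decompositionZ k omega alpha beta : 0 < k ->
  hitchin_decomposition theta omega alpha beta ->
  hitchin_decomposition theta (k \*o omega) (k%:C \*o alpha) (k%:C \*o beta).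
Proof.
move=> k_gt0 [pos neg]; rewrite /hitchin_decomposition hitchin_pfaffianZ.
have k4_gt0 : 0 < k ^+ 4 by exact: exprn_gt0.
rewrite (pmulr_rgt0 _ k4_gt0) (pmulr_rlt0 _ k4_gt0); split=> [gt0|lt0].
  case: (pos gt0) => ad bd e r; 
  split; [exact: real_decomposableZ.. | | exact: top_ratio_wedgeZ].
  by move=> M /=; rewrite -mulrDr -e /to_complex rmorphM.
case: (neg lt0) => ad bE e r; rewrite conj_formZ.
split; [exact: decomposableZ | | | exact: top_ratio_wedgeZ].
  by move=> M /=; rewrite bE.
by move=> M /=; rewrite -mulrDr -e /to_complex rmorphM.
Qed.

End HitchinDecomposition.

(** * The dual form in terms of the normalized decomposition *)

Section DualForm.
Variables (R : realType) (theta : 'M[R]_6 -> R).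
Variables (omega omega_hat : 'M[R]_(3, 6) -> R).
Variables (k : R) (alpha beta : 'M[R]_(3, 6) -> R[i]).
Hypotheses (k_gt0 : 0 < k) (hat : is_dual_form theta omega omega_hat).
Hypothesis dec :
  hitchin_decomposition theta (fun M => omega M / k) alpha beta.

Let pfaffian_scale : hitchin_pfaffian theta (fun M => omega M / k) =
  k^-1 ^+ 4 * hitchin_pfaffian theta omega.
Proof.
rewrite -hitchin_pfaffianZ; congr hitchin_pfaffian.
by apply/funext => M /=; rewrite mulrC.
Qed.

(** The scaled pair also decomposes [omega], so by uniqueness it is the pair that defines
    [omega_hat]. *)
Let dual_decomposition : hitchin_pfaffian theta omega != 0 ->
  exists a b, [/\ hitchin_decomposition theta omega a b,
    a = k%:C \*o alpha, b = k%:C \*o beta,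
    0 < hitchin_pfaffian theta omega ->
          to_complex omega_hat =1 (fun M => a M - b M) &
        hitchin_pfaffian theta omega < 0 ->
          to_complex omega_hat =1
            (fun M => 'i * (conj_form a M - a M))].
Proof.
case: hat => a [b [h hpos hneg]] nz; exists a, b.
have := hitchin_decompositionZ k_gt0 dec.
have -> : k \*o (fun M => omega M / k) = omega.
  by apply/funext => M /=; rewrite mulrC divfK // gt_eqF.
by move=> /(hitchin_decomposition_unique nz h)[? ?]; split.
Qed.

Lemma dual_form_pos M : 0 < hitchin_pfaffian theta omega ->
  [/\ complex.Im (alpha M) = 0, complex.Im (beta M) = 0,
      omega M / k = complex.Re (alpha M) + complex.Re (beta M) &
      omega_hat M / k = complex.Re (alpha M) - complex.Re (beta M)].
Proof.
move=> gt0; case: (dual_decomposition (lt0r_neq0 gt0)) => a [b [_ aE bE]].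
move=> /(_ gt0 M) + _; rewrite aE bE /to_complex /=.
case: dec => /(_ _)[].
  by rewrite pfaffian_scale mulr_gt0 // exprn_gt0 // invr_gt0.
move=> [c1 [c2 [c3 /(_ M)]]] + [d1 [d2 [d3 /(_ M)]]] + /(_ M) + _ _.
rewrite /to_complex => -> -> /(congr1 (@complex.Re R)) /= ->.
move/(congr1 (@complex.Re R)) => /= ->; split=> //.
by rewrite !mul0r !subr0 -mulrBr mulrC mulKf // gt_eqF.
Qed.

Lemma dual_form_neg M : hitchin_pfaffian theta omega < 0 ->
  [/\ complex.Re (beta M) = complex.Re (alpha M),
      complex.Im (beta M) = - complex.Im (alpha M),
      omega M / k = 2 * complex.Re (alpha M) &
      omega_hat M / k = 2 * complex.Im (alpha M)].
Proof.
move=> lt0; case: (dual_decomposition (ltr0_neq0 lt0)) => a [b [_ aE bE _ /(_ lt0)]].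
move=> /(_ M); rewrite aE conj_formZ /to_complex /conj_form /=.
case: dec => _ /(_ _)[].
  by rewrite pfaffian_scale pmulr_rlt0 // exprn_gt0 // invr_gt0.
move=> _ /(_ M) -> /(_ M) + _; rewrite /to_complex /conj_form.
(* With [alpha = x + i y], the sum [alpha + conj alpha] is [2 x] and [i (conj alpha - alpha)] is
   [2 y]. *)
case: (alpha M) => x y /= /(congr1 (@complex.Re R)) /= ->.
move/(congr1 (@complex.Re R)) => /= ->; split=> //; first by ring.
by field; rewrite gt_eqF.
Qed.

End DualForm.

(** * Exterior derivatives *)

Lemma derive_lincomb (R : realType) (V : normedModType R) (f g : V -> R)
    (a b : R) (x v : V) :
  derivable f x v -> derivable g x v ->
  'D_v (fun y => a * f y + b * g y) x = a * 'D_v f x + b * 'D_v g x.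
Proof.
move=> df dg; rewrite -[a * _]/(a *: _) -[b * _]/(b *: _).
have adf : derivable (a \*: f) x v by exact: derivableZ.
have bdg : derivable (b \*: g) x v by exact: derivableZ.
by rewrite -(deriveZ a df) -(deriveZ b dg) -(deriveD adf bdg).
Qed.

Section ExteriorDerivative.
Variables (R : realType) (n : nat) (X : manifold R n).

(** Carries a property holding near [x] in [X] to the coordinates, where derivatives are taken. *)
Lemma chart_inv_cvg (i : chart X) (x : X) : chart_dom i x ->
  chart_inv i y @[y --> chart_map i x] --> x.
Proof.
move=> ix; have := @chart_inv_continuous _ _ X i.
rewrite continuous_open_subspace; last exact: codom_open.
move=> /(_ (chart_map i x)) cont; rewrite -[X in _ --> X](coordK (mem_set ix)).
by apply: cont; rewrite inE; exists x.
Qed.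

(** A derivative depends only on the germ. Smoothness is asked of [s1] and [s2] alone, so [t] can be
    a normalized form known only through a pointwise relation. *)
Lemma ext_d_near_linear k (t s1 s2 : ctensor X R k) (a b : R) i x M :
  chart_dom i x -> smooth_form s1 -> smooth_form s2 ->
  (\forall y \near x, forall N, t i y N = a * s1 i y N + b * s2 i y N) ->
  ext_d t i x M = a * ext_d s1 i x M + b * ext_d s2 i x M.
Proof.
move=> ix [[_ _ sm1] _] [[_ _ sm2] _] tE; rewrite /ext_d !mulr_sumr -big_split /=.
apply: eq_bigr => c _; rewrite mulrCA [b * _]mulrCA -mulrDr; congr (_ * _).
set v := row c M; set N := row' c M.
have codom_x : (chart_map i @` chart_dom i) (chart_map i x) by exists x.
(* With the empty list of directions, [smooth_on] speaks of the function itself. *)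
have d1 : derivable (fun y => s1 i (chart_inv i y) N) (chart_map i x) v.
  exact: (sm1 i N [::] _ codom_x).2.
have d2 : derivable (fun y => s2 i (chart_inv i y) N) (chart_map i x) v.
  exact: (sm2 i N [::] _ codom_x).2.
rewrite -(derive_lincomb a b d1 d2); apply: near_eq_derive.
have near_inv : nbhs (chart_map i x) (fun y => forall N,
  t i (chart_inv i y) N = a * s1 i (chart_inv i y) N + b * s2 i (chart_inv i y) N).
  exact: (chart_inv_cvg ix tE).
by apply: filterS near_inv => y /(_ N).
Qed.

Lemma ext_dC_eq0 k (t : ctensor X R[i] k) i x M :
  ext_dC t i x M = 0 <->
  ext_d (fun i x M => complex.Re (t i x M)) i x M = 0 /\
  ext_d (fun i x M => complex.Im (t i x M)) i x M = 0.
Proof. by rewrite /ext_dC; split=> [[-> ->]//|[-> ->]]. Qed.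

End ExteriorDerivative.

(** Here [t] is the value of [theta] and [- 6 * t] that of [Omega^3], because
    [theta = - Omega^3 / 6]. *)
Lemma real_ratio (R : realType) (w t : R[i]) : 0 < w / t -> w / (- 6 * t) < 0.
Proof.
by move=> r_gt0; rewrite invfM mulrCA nmulr_rlt0 // invr_lt0 oppr_lt0 ltr0n.
Qed.

(** The ratio is nonzero and imaginary, hence not comparable with 0 in [R[i]]: were it negative,
    ['i] would be positive. *)
Lemma imaginary_ratio (R : realType) (w t : R[i]) :
  0 < w / ('i * t) -> (w / (- 6 * t) < 0) = false.
Proof.
move=> r_gt0; apply/negbTE/negP => q_lt0.
have nz6 : - 6 != 0 :> R[i] by rewrite oppr_eq0 pnatr_eq0.
have qE : w / (- 6 * t) * (- 6 / 'i) = w / ('i * t).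
  by rewrite !invfM mulrACA -!mulrA mulVKf // [t^-1 * _]mulrC.
move: r_gt0; rewrite -qE (nmulr_rgt0 _ q_lt0) mulNr oppr_lt0.
rewrite pmulr_rgt0 ?ltr0n // invr_gt0 ltcE /= oner_eq0.
by [].
Qed.

(** * Integrability of the associated structure *)

Section AssociatedStructure.
Variables (R : realType) (X : manifold R 6).
Variables (Omega : ctensor X R 2) (omega omega_hat : ctensor X R 3).
Variable S : generalized_almost_CY X.
Hypothesis nondeg : nondegenerate_MA Omega omega.
Hypothesis assoc : associated_acy Omega omega S.
Local Notation lambda := (pfaffian Omega omega).

Let scale_gt0 i x : chart_dom i x -> 0 < `|lambda i x| `^ 4%:R^-1.
Proof. by move=> ix; rewrite powR_gt0 // normr_gt0 nondeg. Qed.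

Let lambda_normalize i x : chart_dom i x ->
  exists2 c, 0 < c & hitchin_pfaffian (theta_form (Omega i x))
    (normalize Omega omega omega i x) = c * lambda i x.
Proof.
move=> ix; exists ((`|lambda i x| `^ 4%:R^-1)^-1 ^+ 4).
  by rewrite exprn_gt0 // invr_gt0 scale_gt0.
rewrite -hitchin_pfaffianZ; congr hitchin_pfaffian.
by apply/funext => M /=; rewrite mulrC.
Qed.

(* (alpha ^ beta) / Omega^3 is negative where lambda > 0 and imaginary where
   lambda < 0, so that its local constancy forces lambda to keep its sign. *)
Lemma pfaffian_sign_near i x : chart_dom i x ->
  \forall y \near x, chart_dom i y /\ (0 < lambda i y) = (0 < lambda i x).
Proof.
move=> ix.
pose ratio z := top_ratio (wedge (acy_alpha S i z) (acy_beta S i z))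
  (to_complex (wedge (acy_Omega S i z) (wedge (acy_Omega S i z) (acy_Omega S i z)))).
have signE z : chart_dom i z -> (0 < lambda i z) = (ratio z < 0).
  move=> iz; have [c c_gt0 cE] := lambda_normalize iz.
  have [/funext OmegaE _ _ [pos neg]] := assoc iz.
  rewrite cE in pos neg.
  have thetaE : (wedge (Omega i z) (wedge (Omega i z) (Omega i z)) 1%:M)%:C
      = - 6 * (theta_form (Omega i z) 1%:M)%:C.
    rewrite /theta_form; move: (wedge (Omega i z) _ _) => w.
    by rewrite rmorphN rmorphM fmorphV rmorph_nat mulrNN mulVKf ?pnatr_eq0.
  rewrite /ratio OmegaE /top_ratio /to_complex thetaE.
  set w := wedge _ _ _; set th := (theta_form _ _)%:C.
  move: (nondeg iz); rewrite neq_lt => /orP[lt0|gt0].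
    rewrite lt_gtF //; apply/esym/negbTE/negP => ratio_lt0.
    have [|_ /funext bE _] := neg; first by rewrite pmulr_rlt0.
    rewrite -bE /top_ratio -/w -[to_complex _ _]/th => r_gt0.
    by move: ratio_lt0; rewrite (imaginary_ratio r_gt0).
  rewrite gt0; apply/esym.
  have [|_ _ _] := pos; first by rewrite pmulr_rgt0.
  rewrite /top_ratio -/w -[to_complex _ _]/th => r_gt0.
  exact: real_ratio.
have dom_near : \forall y \near x, chart_dom i y.
  exact: open_nbhs_nbhs (conj (dom_open i) ix).
have const := acy_constant S ix.
near=> y; have iy : chart_dom i y by near: y.
split=> //; rewrite !signE //; congr (_ < 0); near: y; exact: const.
Unshelve. all: by end_near. Qed.

Hypothesis dual : dual_form Omega omega omega_hat.
Local Notation alpha := (acy_alpha S).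
Local Notation beta := (acy_beta S).
Local Notation part f t := (fun i x M => f (t i x M)).

Lemma associated_ext_d i x M : chart_dom i x ->
  ext_dC alpha i x M = 0 /\ ext_dC beta i x M = 0 <->
  ext_d (normalize Omega omega omega) i x M = 0 /\
  ext_d (normalize Omega omega omega_hat) i x M = 0.
Proof.
move=> ix; rewrite !ext_dC_eq0.
have [sRa sIa] := acy_alpha_form S; have [sRb sIb] := acy_beta_form S.
have sign_near := pfaffian_sign_near ix.
move: (nondeg ix); rewrite neq_lt => /orP[lt0|gt0].
  have near_neg : \forall y \near x, forall N,
      [/\ complex.Re (beta i y N) = complex.Re (alpha i y N),
          complex.Im (beta i y N) = - complex.Im (alpha i y N),
          normalize Omega omega omega i y N = 2 * complex.Re (alpha i y N) &
          normalize Omega omega omega_hat i y N = 2 * complex.Im (alpha i y N)].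
    apply: filterS sign_near => y [iy sy] N; have [_ _ _ dec] := assoc iy.
    apply: (dual_form_neg (scale_gt0 iy) (dual iy) dec).
    (* [pfaffian_sign_near] only transports the truth value of [0 < lambda]; nondegeneracy turns its
       failure into [lambda < 0]. *)
    by rewrite lt_neqAle nondeg //= leNgt [0 < _]sy lt_gtF.
  (* All derivatives are written through those of [Re alpha] and [Im alpha], with zero coefficients
     padding each relation to two terms. *)
  have dRb : ext_d (part (@complex.Re R) beta) i x M =
      1 * ext_d (part (@complex.Re R) alpha) i x M
      + 0 * ext_d (part (@complex.Im R) alpha) i x M.
    apply: ext_d_near_linear => //; apply: filterS near_neg => y + N.
    by case/(_ N) => -> _ _ _; ring.
  have dIb : ext_d (part (@complex.Im R) beta) i x M =
      0 * ext_d (part (@complex.Re R) alpha) i x M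
      + -1 * ext_d (part (@complex.Im R) alpha) i x M.
    apply: ext_d_near_linear => //; apply: filterS near_neg => y + N.
    by case/(_ N) => _ -> _ _; ring.
  have dw : ext_d (normalize Omega omega omega) i x M =
      2 * ext_d (part (@complex.Re R) alpha) i x M
      + 0 * ext_d (part (@complex.Im R) alpha) i x M.
    apply: ext_d_near_linear => //; apply: filterS near_neg => y + N.
    by case/(_ N) => _ _ -> _; ring.
  have dwh : ext_d (normalize Omega omega omega_hat) i x M =
      0 * ext_d (part (@complex.Re R) alpha) i x M
      + 2 * ext_d (part (@complex.Im R) alpha) i x M.
    apply: ext_d_near_linear => //; apply: filterS near_neg => y + N.
    by case/(_ N) => _ _ _ ->; ring.
  by rewrite dRb dIb dw dwh; split=> [[[-> ->] _]|[h1 h2]]; lra.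
have near_pos : \forall y \near x, forall N,
    [/\ complex.Im (alpha i y N) = 0, complex.Im (beta i y N) = 0,
        normalize Omega omega omega i y N
          = complex.Re (alpha i y N) + complex.Re (beta i y N) &
        normalize Omega omega omega_hat i y N
          = complex.Re (alpha i y N) - complex.Re (beta i y N)].
  apply: filterS sign_near => y [iy sy] N; have [_ _ _ dec] := assoc iy.
  apply: (dual_form_pos (scale_gt0 iy) (dual iy) dec).
  by rewrite [_ < _]sy.
(* Here the independent derivatives are those of [Re alpha] and [Re beta]; their sum and difference
   vanish exactly when both do. *)
have dIa : ext_d (part (@complex.Im R) alpha) i x M =
    0 * ext_d (part (@complex.Re R) alpha) i x M
    + 0 * ext_d (part (@complex.Re R) beta) i x M.
  apply: ext_d_near_linear => //; apply: filterS near_pos => y + N.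
  by case/(_ N) => -> _ _ _; ring.
have dIb : ext_d (part (@complex.Im R) beta) i x M =
    0 * ext_d (part (@complex.Re R) alpha) i x M
    + 0 * ext_d (part (@complex.Re R) beta) i x M.
  apply: ext_d_near_linear => //; apply: filterS near_pos => y + N.
  by case/(_ N) => _ -> _ _; ring.
have dw : ext_d (normalize Omega omega omega) i x M =
    1 * ext_d (part (@complex.Re R) alpha) i x M
    + 1 * ext_d (part (@complex.Re R) beta) i x M.
  apply: ext_d_near_linear => //; apply: filterS near_pos => y + N.
  by case/(_ N) => _ _ -> _; ring.
have dwh : ext_d (normalize Omega omega omega_hat) i x M =
    1 * ext_d (part (@complex.Re R) alpha) i x M
    + -1 * ext_d (part (@complex.Re R) beta) i x M.
  apply: ext_d_near_linear => //; apply: filterS near_pos => y + N.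
  by case/(_ N) => _ _ _ ->; ring.
by rewrite dIa dIb dw dwh; split=> [[[-> _] [-> _]]|[h1 h2]]; lra.
Qed.

End AssociatedStructure.

Theorem proposition1p3 (R : realType) (X : manifold R 6)
    (Omega : ctensor X R 2) (omega : ctensor X R 3)
    (hMA : monge_ampere Omega omega) (hnd : nondegenerate_MA Omega omega)
    (omega_hat : ctensor X R 3) (hdual : dual_form Omega omega omega_hat)
    (S : generalized_almost_CY X) (hS : associated_acy Omega omega S) :
  integrable_acy S <->
  closed_form (normalize Omega omega omega) /\
  closed_form (normalize Omega omega omega_hat).
Proof.
have dE i x M (ix : chart_dom i x) := associated_ext_d hnd hS hdual M ix.
split=> [[da db]|[dw dwh]]; split=> i x ix M.
- by case: ((dE i x M ix).1 (conj (da i x ix M) (db i x ix M))).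
- by case: ((dE i x M ix).1 (conj (da i x ix M) (db i x ix M))).
- by case: ((dE i x M ix).2 (conj (dw i x ix M) (dwh i x ix M))).
- by case: ((dE i x M ix).2 (conj (dw i x ix M) (dwh i x ix M))).
Qed.
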